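(* There is an absolute constant $C$ such that for all $\delta,D\ge 1$ there exist parameters $\eta^*>0$ and $\beta^*>1$ (depending only on $\delta,D$) for which the GR-BAL algorithm run with $(\eta,\beta)=(\eta^*,\beta^* )$ is a feasible online policy on all instances satisfying the locally bounded reward assumption with parameters $\delta,D$ and having integer-valued durations, and on this class of instances it is asymptotically $\Gamma(\delta,D)$-competitive as $c_{\min}:=\min_i c_i\to\infty$, where $$\Gamma(\delta,D)=\ln(\delta D)+\ln\ln(\delta\vee D)+C\quad\text{if }\ln(\delta\vee D)\ge e-1,\qquad \Gamma(\delta,D)=C\quad\text{otherwise.}$$
   Context: Notation: $[k]=\{1,\dots,k\}$, $[0]=\emptyset$, $a\vee b=\max(a,b)$, $a\wedge b=\min(a,b)$. Model. There are $n$ servers $[n]$; server $i$ has integer capacity $c_i\ge1$. Jobs $1,\dots,m$ are revealed one at a time in index order, with real arrival times $0\le t_1\le\dots\le t_m$ (jobs with equal arrival times are still revealed one after another). $E\subseteq[n]\times[m]$ is the set of compatible pairs and $\mathcal N(j)=\{i:(i,j)\in E\}$. Each $(i,j)\in E$ has a reward rate $r_{ij}>0$ and a duration $d_{ij}>0$. When job $j$ is revealed (with $t_j$, $\mathcal N(j)$ and $(r_{ij},d_{ij})_{i\in\mathcal N(j)}$), the algorithm must irrevocably assign it to one server in $\mathcal N(j)$ or reject it, without knowledge of later jobs. A job $j$ assigned to $i$ occupies one unit of capacity of $i$ during $[t_j,t_j+d_{ij})$ and yields reward $r_{ij}d_{ij}$. A policy is feasible if for every server $i$ and time $t\ge0$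 the number of jobs $j$ assigned to $i$ with $t_j\le t<t_j+d_{ij}$ is at most $c_i$. $\mathrm{ALG}(I)$ is the total reward collected by the algorithm on instance $I$; $\mathrm{OPT}(I)$ is the maximum total reward of a feasible (integral) assignment computed with full knowledge of $I$. Locally bounded reward assumption (parameters $\delta,D\ge1$, known to the algorithm): $1\le d_{ij}\le D$ for all $(i,j)\in E$; and $1/\delta\le r_{ij}/r_{ij'}\le\delta$ whenever $i\in\mathcal N(j)\cap\mathcal N(j')$ and $|t_j-t_{j'}|\le D$. An online algorithm is asymptotically $\Gamma$-competitive on a class of instances if $\limsup_{\min_i c_i\to\infty}\ \sup_{I}\mathrm{OPT}(I)/\mathbb E[\mathrm{ALG}(I)]\le\Gamma$, the supremum being over all finite instances $I$ of the class with server capacities $\{c_i\}$ (instances with $\mathrm{OPT}(I)=0$ are disregarded). BALANCE framework. Given losses $\mathcal L_{ij}$, when job $j$ arrives: if $\max_{i\in\mathcal N(j)}\{r_{ij}d_{ij}-\mathcal L_{ij}\}>0$, assign $j$ to a server attaining this maximum; otherwise leave $j$ unassigned. GR-BAL. Let $\Psi(x)=\eta(\beta^{1-x}-1)$ with $\eta>0,\beta>1$. For $T_1<T_2$ let $\mathcal T[T_1,T_2)=\{T_1,T_1+1,\dots,T_1+\lceil T_2-T_1-1\rceil\}$. For $(i,j)\in E$ and $t\ge t_j$, let $\tilde{\boldsymbol r}_{i,j,t}$ be the multiset of reward rates $r_{ih}$ of the jobs $h<j$ that were assigned to $i$ and remain active at time $t$ (i.e. $t<t_h+d_{ih}$); $|\tilde{\boldsymbol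 r}_{i,j,t}|$ is its cardinality, $\tilde r^{(\ell)}_{i,j,t}$ its $\ell$-th largest element, and $\tilde r^{(0)}_{i,j,t}=+\infty$. GR-BAL is the BALANCE framework with $$\mathcal L_{ij}=\mathcal L^{\mathrm{GR}}_{ij}=\sum_{\tau\in\mathcal T[t_j,t_j+d_{ij})}\ \max_{\ell\in\{0\}\cup[|\tilde{\boldsymbol r}_{i,j,\tau}|]}\bigl(\tilde r^{(\ell)}_{i,j,\tau}\wedge r_{ij}\bigr)\Psi(1-\ell/c_i).$$ *)

(* Defs.v *)
From mathcomp Require Import all_boot all_order all_algebra.
From mathcomp Require Import all_classical all_reals all_analysis.

Set Implicit Arguments.
Unset Strict Implicit.
Unset Printing Implicit Defensive.

Import Order.TTheory GRing.Theory Num.Theory.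
Local Open Scope classical_set_scope.
Local Open Scope ring_scope.

Record system := System {
  nserv : nat;
  cap : 'I_nserv -> nat;
  cap_gt0 : forall i, (0 < cap i)%N }.

Section Model.
Context {R : realType}.

(* The information revealed with a job. [rate J i] and [dur J i] are meaningful
   only for [i \in compat J]. *)
Record job (n : nat) := Job {
  arr : R;
  compat : {set 'I_n};
  rate : 'I_n -> R;
  dur : 'I_n -> R }.

(* Jobs in order of revelation, each with its decision; [None] is rejection. *)
Definition history n := seq (job n * option 'I_n).

Definition assigned n (i : 'I_n) (x : job n * option 'I_n) := x.2 == Some i.

Definition feasible (S : system) (h : history (nserv S)) : Prop :=
  all (fun x => if x.2 is Some i then i \in compat x.1 else true) h /\
  forall (i : 'I_(nserv S)) (t : R), 0 <= t ->
    (count (fun x => assigned i x && (arr x.1 <= t < arr x.1 + dur x.1 i)%R) h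
      <= cap i)%N.

Definition reward n (h : history n) : R :=
  \sum_(x <- h) (if x.2 is Some i then rate x.1 i * dur x.1 i else 0).

(* A finite instance: the jobs in order of revelation. *)
Record instance (n : nat) := Instance {
  njobs : nat;
  jobs : njobs.-tuple (job n) }.

Definition well_formed n (I : instance n) : Prop :=
  [/\ forall j, 0 <= arr (tnth (jobs I) j),
      forall j j' : 'I_(njobs I), (j <= j')%N ->
        arr (tnth (jobs I) j) <= arr (tnth (jobs I) j') &
      forall j i, i \in compat (tnth (jobs I) j) ->
        0 < rate (tnth (jobs I) j) i /\ 0 < dur (tnth (jobs I) j) i].

(* The rejection of all jobs is feasible with reward 0, so 0 is a harmless
   default for this maximum over a finite nonempty set. *)
Definition OPT (S : system) (I : instance (nserv S)) : R :=
  \big[Num.max/0]_(a : (njobs I).-tuple (option 'I_(nserv S))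
                   | `[< feasible (zip (jobs I) a) >])
    reward (zip (jobs I) a).

(* A deterministic online algorithm decides on the newly revealed job from the
   capacities, the jobs revealed so far and its own past decisions. *)
Definition online_alg :=
  forall S : system, history (nserv S) -> job (nserv S) ->
    option 'I_(nserv S).

Definition run (A : online_alg) (S : system) (I : instance (nserv S)) :
    history (nserv S) :=
  foldl (fun h J => rcons h (J, A S h J)) [::] (jobs I).

Definition ALG (A : online_alg) (S : system) (I : instance (nserv S)) : R :=
  reward (run A I).

Definition locally_bounded (delta D : R) n (I : instance n) : Prop :=
  (forall j i, i \in compat (tnth (jobs I) j) ->
     1 <= dur (tnth (jobs I) j) i <= D) /\
  (forall j j' i,
     i \in compat (tnth (jobs I) j) -> i \in compat (tnth (jobs I) j') ->
     `|arr (tnth (jobs I) j) - arr (tnth (jobs I) j')| <= D ->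
     delta^-1 <= rate (tnth (jobs I) j) i / rate (tnth (jobs I) j') i <= delta).

Definition integer_durations n (I : instance n) : Prop :=
  forall j i, i \in compat (tnth (jobs I) j) ->
    dur (tnth (jobs I) j) i \is a Num.int.

Definition instance_class := forall n, set (instance n).

Definition is_cmin (S : system) (k : nat) : Prop :=
  (exists i : 'I_(nserv S), cap i = k) /\
  (forall i : 'I_(nserv S), (k <= cap i)%N).

(* Supremum of the ratios over all instances of [K], over all systems (with any
   number of servers) whose least capacity is [k]; [EALG S I] is the expected
   reward of the algorithm on [I]. In [\bar R], [x / 0 = +oo] for [x > 0]. *)
Definition worst_ratio (K : instance_class)
    (EALG : forall S : system, instance (nserv S) -> R) (k : nat) : \bar R :=
  ereal_sup [set x | exists (S : system) (I : instance (nserv S)),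
    [/\ is_cmin S k, K _ I, OPT I != 0 &
        x = ((OPT I)%:E / (EALG S I)%:E)%E]].

(* The limit superior as the least capacity tends to infinity. *)
Definition asymptotically_competitive (K : instance_class)
    (EALG : forall S : system, instance (nserv S) -> R) (Gamma : R) : Prop :=
  (limn_esup (worst_ratio K EALG) <= Gamma%:E)%E.

(* A loss assigns to the new job [J] and each server a number depending on the
   history before [J]. *)
Definition loss_fun :=
  forall S : system, history (nserv S) -> job (nserv S) -> 'I_(nserv S) -> R.

(* Ties are broken arbitrarily, possibly depending on all past information. *)
Definition is_balance (L : loss_fun) (A : online_alg) : Prop :=
  forall (S : system) (h : history (nserv S)) (J : job (nserv S)),
    let profit i := rate J i * dur J i - L S h J i in
    match A S h J with
    | Some i => [/\ i \in compat J, 0 < profit i &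
                    forall i', i' \in compat J -> profit i' <= profit i]
    | None => forall i, i \in compat J -> profit i <= 0
    end.

Definition Psi (eta beta x : R) : R := eta * (beta `^ (1 - x) - 1).

(* {T1, T1 + 1, ..., T1 + ceil (T2 - T1 - 1)} for T1 < T2; the ceiling is then
   nonnegative, so [absz] is the identity on it. *)
Definition grid (T1 T2 : R) : seq R :=
  [seq T1 + k%:R | k <- iota 0 `|Num.ceil (T2 - T1 - 1)|%N.+1].

(* Rates of the jobs of [h] on [i] still active at time [t], as a sequence with
   multiplicities, in nonincreasing order. *)
Definition active_rates n (h : history n) (i : 'I_n) (t : R) : seq R :=
  sort >=%R [seq rate x.1 i
            | x <- h & assigned i x && (t < arr x.1 + dur x.1 i)].

(* Minimum of [r] and the [l]-th largest element of the nonincreasing sequence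
   [s], counted from 1; the 0-th largest element is +oo. *)
Definition capped_rate (s : seq R) (r : R) (l : nat) : R :=
  if l is k.+1 then Num.min (nth 0 s k) r else r.

Definition gr_loss (eta beta : R) : loss_fun := fun S h J i =>
  \sum_(tau <- grid (arr J) (arr J + dur J i))
    let s := active_rates h i tau in
    let term l := capped_rate s (rate J i) l *
                  Psi eta beta (1 - l%:R / (cap i)%:R) in
    \big[Num.max/term 0%N]_(l < (size s).+1) term l.

Definition is_GR_BAL (eta beta : R) : set online_alg :=
  is_balance (gr_loss eta beta).

Definition Gamma_ratio (C delta D : R) : R :=
  if expR 1 - 1 <= ln (Num.max delta D)
  then ln (delta * D) + ln (ln (Num.max delta D)) + C
  else C.

End Model.

Arguments job R n : clear implicits.
Arguments history R n : clear implicits.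
Arguments instance R n : clear implicits.
Arguments online_alg R : clear implicits.
Arguments instance_class R : clear implicits.
Arguments loss_fun R : clear implicits.

Definition GR_class (R : realType) (delta D : R) : instance_class R :=
  fun n => [set I | [/\ well_formed I, locally_bounded delta D I &
                        integer_durations I]].

Lemma GR_BAL_exists (R : realType) (eta beta : R) :
  exists A : online_alg R, is_GR_BAL eta beta A.
Proof.
suff H (S : system) (h : history R (nserv S)) (J : job R (nserv S)) :
    exists o : option 'I_(nserv S),
    let profit i := rate J i * dur J i - gr_loss eta beta h J i in
    match o with
    | Some i => [/\ i \in compat J, 0 < profit i &
                    forall i', i' \in compat J -> profit i' <= profit i]
    | None => forall i, i \in compat J -> profit i <= 0
    end.
  exists (fun S h J => sval (cid (H S h J))) => S h J.
  exact: (svalP (cid (H S h J))).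
set profit := fun i => rate J i * dur J i - gr_loss eta beta h J i.
case: (set_0Vmem (compat J)) => [J0|[i0 i0J]].
  by exists None => /= i; rewrite J0 inE.
have [i iJ imax] := @arg_maxP _ _ _ i0 (mem (compat J)) profit i0J.
have [i_gt0|i_le0] := ltP 0 (profit i); first by exists (Some i).
by exists None => /= i' i'J; apply: le_trans (imax _ i'J) i_le0.
Qed.

(* Main.v *)
Require Import Defs.
From mathcomp Require Import all_boot all_order all_algebra.
From mathcomp Require Import all_classical all_reals all_analysis.
From mathcomp Require Import ring lra.

Set Implicit Arguments.
Unset Strict Implicit.
Unset Printing Implicit Defensive.

Import Order.TTheory GRing.Theory Num.Theory.

Local Open Scope ring_scope.

(** Write [q = beta^(1/c)] for a server of capacity [c]. The profit maximised by
    the algorithm makes OPT at most the sum of the profits plus the losses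
    [L_ij] over the OPT pairs [(i, j)]. On one server, the loss at a time [y] is
    bounded by its final uncapped value, which telescopes over the jobs [h] of
    the algorithm active at [y]: each contributes at most [q - 1] times its own
    loss at [y] plus [eta r_h]. This contribution is nonincreasing in [y], and,
    durations being integers, at most [c] grid points of OPT jobs fall in each
    unit block of [h]; hence the OPT losses are at most
    [c (q - 1) (sum_h L_h + eta r_h d_h)]. As [L_h <= r_h d_h], the ratio is
    [K (1 + eta)] for every [K >= 1] bounding all [c (q - 1)], and
    [c (q - 1) -> ln beta]. Feasibility needs [eta (beta - 1) >= delta D];
    [eta = 1 / ln beta] and [ln beta = ln (delta D) + ln M + 3], with
    [M = max (ln (max delta D), e - 1)], meet this up to an additive constant. *)

(** * Loss at a single time, as a function of the multiset of active rates *)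

Section LevelLoss.
Context {R : realType}.
Implicit Types (s : seq R) (r z B : R) (k : nat).

(** With [count_nth_sort], this trades positions in the sorted list for counts above thresholds, so
    that multisets can be compared without sorting. The first [k] places hold at most [k] of the
    elements [>= z], so one lies further on. *)
Lemma le_nth_sort s z k : (k < count (>= z) s)%N -> z <= nth 0 (sort >=%R s) k.
Proof.
rewrite -(count_sort >=%R (fun y => z <= y) s).
set t := sort _ s => kz; rewrite leNgt; apply/negP => ltz.
have t_sorted : sorted >=%R t by apply: sort_sorted => x y; exact: le_total.
have : (count (>= z) (take k t) <= k)%N.
  by rewrite (leq_trans (count_size _ _))// size_take_min geq_minl.
move: kz; rewrite -{1}(cat_take_drop k t) count_cat => /leq_trans kz lek.
have : has (>= z) (drop k t).
  rewrite has_count -(ltn_add2l (count (>= z) (take k t))) addn0.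
  exact: leq_ltn_trans lek (kz _ (leqnn _)).
move=> /(has_nthP 0)[j]; rewrite size_drop nth_drop ltn_subRL => ltj /= lez.
have := @sorted_leq_nth _ >=%R ge_trans (@ge_refl _ _) 0 t t_sorted k (k + j).
rewrite !inE (leq_ltn_trans (leq_addr j k) ltj) ltj leq_addr => /(_ isT isT isT).
by move=> /(le_trans lez)/le_lt_trans/(_ ltz); rewrite ltxx.
Qed.

Lemma count_nth_sort s k : (k < size s)%N ->
  (k < count (>= nth 0%R (sort >=%R s) k) s)%N.
Proof.
rewrite -(count_sort >=%R (fun y => _ <= y) s) -(size_sort >=%R s).
set t := sort _ s => kt.
have t_sorted : sorted >=%R t by apply: sort_sorted => x y; exact: le_total.
have kt' : size (take k.+1 t) = k.+1 by rewrite size_takel.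
rewrite -[X in count _ X](cat_take_drop k.+1 t) count_cat ltn_addr//.
rewrite -[leqLHS]kt' eq_leq//; apply/esym/eqP; rewrite -all_count.
apply/(all_nthP 0) => j; rewrite kt' => jk /=.
rewrite nth_take//.
by apply: (@sorted_leq_nth _ >=%R ge_trans (@ge_refl _ _) 0 t t_sorted);
  rewrite ?inE ?(leq_ltn_trans _ kt)// -ltnS.
Qed.

Context (eta q : R) (eta_gt0 : 0 < eta) (q_ge1 : 1 <= q).

(** With [q = beta^(1/c)] this is [Psi eta beta (1 - k / c)]; the integer exponent makes the passage
    from [k] to [k.+1] algebraic. *)
Definition level_weight k := eta * (q ^+ k - 1).

(** The inner maximum of [gr_loss] at one grid point. *)
Definition level_loss s r :=
  let t := sort >=%R s in
  let term l := capped_rate t r l * level_weight l in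
  \big[Num.max/term 0%N]_(l < (size t).+1) term l.

Lemma level_weight0 : level_weight 0 = 0.
Proof. by rewrite /level_weight expr0 subrr mulr0. Qed.

Lemma level_weight_ge0 k : 0 <= level_weight k.
Proof. by rewrite mulr_ge0 ?(ltW eta_gt0)// subr_ge0 exprn_ege1. Qed.

Lemma level_weightS k :
  level_weight k.+1 = level_weight k + (q - 1) * (level_weight k + eta).
Proof. by rewrite /level_weight exprS; ring. Qed.

Lemma level_loss_ge0 s r : 0 <= level_loss s r.
Proof.
apply: le_trans (bigmax_ge_id _ _ _ _).
by rewrite level_weight0 mulr0.
Qed.

Lemma level_loss_ge s r z k : (k <= count (>= z) s)%N ->
  Num.min z r * level_weight k <= level_loss s r.
Proof.
case: k => [|k] kz; first by rewrite level_weight0 mulr0 level_loss_ge0.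
have ks : (k.+1 < (size (sort >=%R s)).+1)%N.
  by rewrite ltnS size_sort (leq_trans kz)// count_size.
apply: le_trans (le_bigmax _ _ (Ordinal ks)) => /=.
by rewrite ler_wpM2r ?level_weight_ge0// le_min2 // le_nth_sort.
Qed.

Lemma level_loss_le s r B : 0 <= B ->
  (forall z k, z \in s -> (k < count (>= z) s)%N ->
     Num.min z r * level_weight k.+1 <= B) ->
  level_loss s r <= B.
Proof.
move=> B0 sB; apply: bigmax_le => [|[[|k] /= ks] _].
- by rewrite level_weight0 mulr0.
- by rewrite level_weight0 mulr0.
- move: ks; rewrite ltnS size_sort => ks.
  by apply: sB; rewrite ?count_nth_sort// -(mem_sort >=%R) mem_nth// size_sort.
Qed.

(** By [level_loss_ge] and [level_loss_le] the loss is governed by pairs of a threshold and a level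
    that the rates reach; every pair reached in [s] is reached in [s']. *)
Lemma le_level_loss s s' r r' : r <= r' ->
  (forall z, (count (>= z) s <= count (>= z) s')%N) ->
  level_loss s r <= level_loss s' r'.
Proof.
move=> rr' ss'; apply: level_loss_le (level_loss_ge0 _ _) _ => z k zs kz.
apply: le_trans (level_loss_ge _ (leq_trans kz (ss' z))).
by rewrite ler_wpM2r ?level_weight_ge0// le_min2.
Qed.

(* Inserting [r] shifts the levels of the rates below [r] by one; for such a
   rate the weight grows by [(q - 1) * (level_weight k + eta)], and the first
   term is dominated by the loss charged to [r] at insertion. *)
Lemma level_loss_rcons s r B : 0 <= r ->
  level_loss (rcons s r) B
    <= level_loss s B + (q - 1) * (level_loss s r + eta * r).
Proof.
move=> r0; have q0 : 0 <= q - 1 by rewrite subr_ge0.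
have inc0 : 0 <= (q - 1) * (level_loss s r + eta * r).
  by rewrite mulr_ge0// addr_ge0 ?level_loss_ge0// mulr_ge0// ltW.
apply: level_loss_le => [|z k _]; first by rewrite addr_ge0// level_loss_ge0.
rewrite -cats1 count_cat /= addn0.
have [zr|rz] := leP z r; last first.
  by rewrite addn0 => kz; rewrite ler_wpDr// level_loss_ge.
rewrite addn1 ltnS => kz; rewrite level_weightS mulrDr lerD ?level_loss_ge//.
rewrite mulrCA ler_wpM2l// mulrDr lerD//.
  apply: le_trans (level_loss_ge r kz).
  by rewrite ler_wpM2r ?level_weight_ge0// (min_l zr) ge_min lexx.
by rewrite mulrC ler_pM2l// ge_min zr.
Qed.

End LevelLoss.

(** * Counting grid points and simultaneously active jobs *)

Lemma sum_at_most_one {R : realType} (n : nat) (P : pred nat) (Q : bool) (x : R) :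
  0 <= x ->
  (forall k k', (k < n)%N -> (k' < n)%N -> P k -> P k' -> k = k') ->
  (forall k, (k < n)%N -> P k -> Q) ->
  \sum_(k < n) (if P k then x else 0) <= if Q then x else 0.
Proof.
move=> x0 P1 PQ; have [/existsP[k Pk]|] := boolP [exists k : 'I_n, P k].
  rewrite (PQ k)// (bigD1 k)//= Pk big1 ?addr0// => k' k'k; case: ifP => // Pk'.
  by case/negP: k'k; apply/eqP/val_inj/(P1 _ _ (ltn_ord k') (ltn_ord k)).
rewrite negb_exists => /forallP nP; rewrite big1; first by case: ifP.
by move=> k _; rewrite (negbTE (nP k)).
Qed.

Lemma sum_ord_const {R : realType} (m : nat) (P : pred nat) (x : R) :
  \sum_(p < m | P p) x = x *+ count P (iota 0 m).
Proof.
by rewrite -(big_mkord P (fun=> x)) big_const_seq iter_addr_0 /index_iota subn0.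
Qed.

Lemma sub_in_count (T : eqType) (a b : pred T) (s : seq T) :
  {in s, subpred a b} -> (count a s <= count b s)%N.
Proof.
move=> ab; rewrite (@eq_in_count _ a (predI a b)) ?sub_count//.
  by move=> x /andP[].
by move=> x xs /=; case: (boolP (a x)) => // /(ab x xs) ->.
Qed.

Section Points.
Context {R : realType}.
Implicit Types (t u : R) (g : R -> R) (c m n d : nat).

(* A job with start [u] and integer duration [d] has at most one of its grid
   points [u + k] in each unit block [[t + m, t + m + 1[], and only if it is
   active during the end of this block. *)
Lemma sum_grid_le g t u n d :
  (forall y, 0 <= g y) -> (forall y y', t <= y -> y <= y' -> g y' <= g y) ->
  \sum_(k < d) (if t <= u + k%:R < t + n%:R then g (u + k%:R) else 0)
   <= \sum_(m < n) (if u < t + m%:R + 1 <= u + d%:R then g (t + m%:R) else 0).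
Proof.
move=> g0 gle.
pose P m k := t + m%:R <= u + k%:R < t + m%:R + 1.
apply: (@le_trans _ _ (\sum_(k < d) \sum_(m < n)
    (if P m k then g (t + m%:R) else 0))).
  apply: ler_sum => k _; case: ifPn => [/andP[tu un]|_]; last first.
    by apply: sumr_ge0 => m _; case: ifP.
  (* The block of a grid point is the integer part of its distance to [t]. *)
  have y0 : 0 <= u + k%:R - t by rewrite subr_ge0.
  have /andP[mle mlt] := truncn_itv y0; set m := Num.truncn _ in mle mlt.
  have mn : (m < n)%N by rewrite -(ltr_nat R) (le_lt_trans mle)// ltrBlDl.
  rewrite (bigD1 (Ordinal mn))//= {1}/P.
  have -> : t + m%:R <= u + k%:R < t + m%:R + 1.
    rewrite -natr1 ltrBlDl addrA in mlt.
    by rewrite -lerBrDl mle.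
  apply: ler_wpDr; first by apply: sumr_ge0 => j _; case: ifP.
  by apply: gle; [rewrite lerDl|rewrite -lerBrDl].
rewrite exchange_big; apply: ler_sum => m _ /=.
have lt1 (k k' : nat) : P m k -> P m k' -> (k' <= k)%N.
  move=> /andP[k1 _] /andP[_ k2]; rewrite -ltnS -(ltr_nat R) -natr1.
  by rewrite -(ltrD2l u) (lt_le_trans k2)// addrA lerD2r.
apply: (@sum_at_most_one _ d (P m)) => // [k k' _ _ Pk Pk'|k kd /andP[k1 k2]].
  by apply/eqP; rewrite eqn_leq !lt1.
rewrite (le_lt_trans _ k2) ?lerDl//= (le_trans (lerD k1 (lexx 1)))//.
by rewrite -addrA lerD2l natr1 ler_nat.
Qed.

(** Capacity concerns intervals closed on the left, blocks intervals closed on the right. At the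
    latest start [y < u] among the counted jobs, all of them have started and none has ended. *)
Lemma block_count (t : nat -> R) (d : nat -> nat) (O : pred nat) c m u :
  (forall p, (p < m)%N -> 0 <= t p) ->
  (forall y, 0 <= y ->
     (count (fun p => O p && (t p <= y < t p + (d p)%:R)%R) (iota 0 m) <= c)%N) ->
  (count (fun p => O p && (t p < u <= t p + (d p)%:R)%R) (iota 0 m) <= c)%N.
Proof.
move=> t0 Oc; set P := fun p => _.
have [|] := boolP (has P (iota 0 m)); last by rewrite has_count -leqNgt leqn0 => /eqP->.
move=> /hasP[p0 p0m Pp0].
pose y := \big[Num.max/t p0]_(p <- iota 0 m | P p) t p.
have yu : y < u.
  by apply: bigmax_lt => [|p /andP[_ /andP[]]//]; case/and3P: Pp0.
have tpy p : p \in iota 0 m -> P p -> t p <= y.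
  by move=> pm Pp; exact: le_bigmax_seq.
have y0 : 0 <= y.
  by apply: le_trans (tpy _ p0m Pp0); apply: t0; rewrite mem_iota in p0m.
apply: leq_trans (Oc y y0).
apply: sub_in_count => p pm Pp; have := Pp => /andP[-> /andP[_ ud]].
by rewrite tpy//= (lt_le_trans yu).
Qed.

End Points.

(** * Charging the losses of one assignment to another on a single server *)

Section Server.
Context {R : realType} (eta q : R) (eta_gt0 : 0 < eta) (q_ge1 : 1 <= q).
Context (t r : nat -> R) (d : nat -> nat) (X : pred nat).

(** The condition [t k <= y], absent from [active_rates], excludes jobs not yet started when a
    longer history is viewed at time [y]. *)
Definition rates_at (y : R) (p : nat) : seq R :=
  [seq r k | k <- iota 0 p & X k && (t k <= y < t k + (d k)%:R)].

Definition loss_at (p : nat) : R :=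
  \sum_(k < d p) level_loss eta q (rates_at (t p + k%:R) p) (r p).

Lemma loss_at_ge0 p : 0 <= loss_at p.
Proof. by apply: sumr_ge0 => k _; exact: level_loss_ge0. Qed.

Lemma count_rates_at (P : pred R) y p : count P (rates_at y p) =
  count (fun k => P (r k) && (X k && (t k <= y < t k + (d k)%:R))) (iota 0 p).
Proof. by rewrite count_map count_filter. Qed.

Context (m : nat).
Context (t_mono : forall p p', (p <= p')%N -> (p' < m)%N -> t p <= t p').
Context (t_ge0 : forall p, (p < m)%N -> 0 <= t p).
Context (r_ge0 : forall p, (p < m)%N -> X p -> 0 <= r p).

Let g h y := level_loss eta q (rates_at y h) (r h) + eta * r h.

(** Jobs are inserted in order of revelation; the increment from [level_loss_rcons] does not involve
    the cap [B], so any cap gives the same bound. *)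
Lemma level_loss_rates_at y B p : (p <= m)%N ->
  level_loss eta q (rates_at y p) B
   <= \sum_(h < p | X h) (if t h <= y < t h + (d h)%:R then (q - 1) * g h y else 0).
Proof.
elim: p => [_|p IH pm].
  rewrite big_ord0; apply: level_loss_le => //.
rewrite big_mkcond big_ord_recr -big_mkcond /=.
have -> : rates_at y p.+1 = if X p && (t p <= y < t p + (d p)%:R)
    then rcons (rates_at y p) (r p) else rates_at y p.
  rewrite /rates_at -addn1 iotaD filter_cat map_cat /= add0n.
  by case: ifP => _; rewrite ?cats1 ?cats0.
case: ifPn => [/andP[Xp ->]|].
  rewrite Xp (le_trans (level_loss_rcons _ _ _ _ _))// ?r_ge0//.
  by rewrite lerD2r IH// ltnW.
rewrite negb_and => nX; rewrite (_ : (if X p then _ else 0) = 0).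
  by rewrite addr0 IH// ltnW.
by case: ifP nX => //= _ /negbTE ->.
Qed.

Lemma server_bound (O : pred nat) (c : nat) (B : R) :
  (forall p, (p < m)%N -> O p -> r p <= B) ->
  (forall y, 0 <= y ->
     (count (fun p => O p && (t p <= y < t p + (d p)%:R)%R) (iota 0 m) <= c)%N) ->
  \sum_(p < m | O p) loss_at p
    <= c%:R * (q - 1) * \sum_(p < m | X p) (loss_at p + eta * (r p * (d p)%:R)).
Proof.
move=> rB Oc.
(* Used twice: to go back in time with a fixed history, and to extend the history at a fixed
   time. *)
have count_mono (p p' : nat) y y' z : (p <= p')%N ->
    (forall k, (k < p)%N -> t k <= y' < t k + (d k)%:R ->
       t k <= y < t k + (d k)%:R) ->
    (count (>= z) (rates_at y' p) <= count (>= z) (rates_at y p'))%N.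
  move=> pp' yy'; rewrite !count_rates_at.
  rewrite -(subnKC pp') iotaD count_cat (leq_trans _ (leq_addr _ _))//.
  apply: sub_in_count => k; rewrite mem_iota /= => kp /and3P[-> ->].
  exact: yy'.
have gle h : (h < m)%N -> forall y y', t h <= y -> y <= y' -> g h y' <= g h y.
  move=> hm y y' hy yy'; rewrite /g lerD2r le_level_loss// => z.
  apply: count_mono => // k kh /andP[_ yk].
  by rewrite (le_trans _ hy) ?t_mono ?(ltnW kh)//= (le_lt_trans yy').
(* Each loss of [O] is raised to the full history with cap [B], then split over the jobs [h] of
   [X]. *)
apply: (@le_trans _ _ (\sum_(p < m | O p) \sum_(k < d p) \sum_(h < m | X h)
    (if t h <= t p + k%:R < t h + (d h)%:R
     then (q - 1) * g h (t p + k%:R) else 0))).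
  apply: ler_sum => p Op; apply: ler_sum => k _.
  apply: le_trans (level_loss_rates_at (t p + k%:R) B (leqnn m)).
  apply: le_level_loss => //; first exact: rB.
  by move=> z; apply: count_mono => //; exact: ltnW.
under eq_bigr do rewrite exchange_big.
rewrite exchange_big mulr_sumr /=; apply: ler_sum => h Xh.
have gE : loss_at h + eta * (r h * (d h)%:R) = \sum_(j < d h) g h (t h + j%:R).
  by rewrite /g big_split /= sumr_const card_ord mulrA mulr_natr.
have q0 : 0 <= q - 1 by rewrite subr_ge0.
have g0 y : 0 <= (q - 1) * g h y.
  rewrite mulr_ge0// addr_ge0 ?level_loss_ge0// mulr_ge0 ?r_ge0//.
  exact: ltW.
(* For fixed [h], grid points of [p] are moved back to the start of their unit block of [h]. *)
apply: (@le_trans _ _ (\sum_(p < m | O p) \sum_(j < d h)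
    (if t p < t h + j%:R + 1 <= t p + (d p)%:R
     then (q - 1) * g h (t h + j%:R) else 0))).
  apply: ler_sum => p _; apply: (sum_grid_le (g := fun y => (q - 1) * g h y)) => //.
  by move=> y y' hy yy'; rewrite ler_wpM2l// gle.
(* For each block [j] of [h], at most [c] jobs of [O] contribute. *)
rewrite exchange_big -mulrA gE !mulr_sumr; apply: ler_sum => j _.
rewrite -big_mkcondr (sum_ord_const m (fun p => O p &&
  (t p < t h + j%:R + 1 <= t p + (d p)%:R))).
rewrite -[leLHS]mulr_natl ler_wpM2r// ler_nat.
exact: block_count t_ge0 Oc.
Qed.

End Server.

(** * From histories and grids to sequences indexed by natural numbers *)

Section History.
Context {R : realType} {n : nat} (J : nat -> job R n).
Implicit Types (x : nat -> option 'I_n) (i : 'I_n).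

Definition hist x (p : nat) : history R n := [seq (J k, x k) | k <- iota 0 p].

Definition dur_nat i (k : nat) : nat := Num.trunc (dur (J k) i).

Lemma histS x p : hist x p.+1 = rcons (hist x p) (J p, x p).
Proof. by rewrite /hist -addn1 iotaD map_cat cats1 add0n. Qed.

Lemma sum_option (o : option 'I_n) (F : 'I_n -> R) :
  \sum_(i | o == Some i) F i = if o is Some i then F i else 0.
Proof.
case: o => [i|]; last by rewrite big_pred0.
by rewrite (big_pred1 i)// => j; rewrite eq_sym.
Qed.

Lemma reward_hist x m :
  reward (hist x m) =
  \sum_(p < m) \sum_(i | x p == Some i) rate (J p) i * dur (J p) i.
Proof.
rewrite /reward big_map -(big_mkord xpredT
  (fun p => \sum_(i | x p == Some i) rate (J p) i * dur (J p) i)).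
rewrite /index_iota subn0; apply: eq_bigr => p _ /=.
by rewrite (sum_option (x p) (fun i => rate (J p) i * dur (J p) i)).
Qed.

End History.

Lemma feasible_histP {R : realType} (S : system) (J : nat -> job R (nserv S))
    (x : nat -> option 'I_(nserv S)) m :
  feasible (hist J x m) <->
  (forall p i, (p < m)%N -> x p = Some i -> i \in compat (J p)) /\
  (forall i (y : R), 0 <= y ->
     (count (fun p => (x p == Some i) &&
               (arr (J p) <= y < arr (J p) + dur (J p) i)%R) (iota 0 m)
        <= cap i)%N).
Proof.
rewrite /feasible; split=> [] [cx cc]; split.
- move=> p i pm xp; move: cx; rewrite all_map => /allP/(_ p).
  by rewrite mem_iota add0n pm /= xp => /(_ isT).
- by move=> i y y0; have := cc i y y0; rewrite count_map.
- rewrite all_map; apply/allP => p; rewrite mem_iota add0n /= => pm.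
  by case xp: (x p) => [i|//]; exact: cx.
- by move=> i y y0; rewrite count_map; exact: cc.
Qed.

(** For an integer duration the ceiling in [grid] is exact, leaving one point per unit of time. *)
Lemma big_grid {R : realType} (t : R) (d : nat) (F : R -> R) : (0 < d)%N ->
  \sum_(y <- grid t (t + d%:R)) F y = \sum_(k < d) F (t + k%:R).
Proof.
case: d => // d _; rewrite /grid big_map.
have -> : t + d.+1%:R - t - 1 = d%:R by rewrite -natr1; ring.
have -> : Num.ceil (d%:R : R) = d.
  by apply: ceil_def; rewrite lexx andbT intrB ltrBlDr ltrDl.
by rewrite -(big_mkord xpredT (fun k => F (t + k%:R))) /index_iota subn0.
Qed.

Lemma Psi_level {R : realType} (eta beta : R) (l c : nat) : 0 <= beta ->
  Psi eta beta (1 - l%:R / c%:R) = level_weight eta (beta `^ c%:R^-1) l.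
Proof.
move=> b0; rewrite /Psi /level_weight; congr (_ * (_ - 1)).
rewrite -powR_mulrn ?powR_ge0// -powRrM; congr (_ `^ _).
by rewrite mulrC; ring.
Qed.

Lemma gr_loss_hist {R : realType} (eta beta : R) (S : system)
    (J : nat -> job R (nserv S)) (x : nat -> option 'I_(nserv S)) i p :
  0 <= beta ->
  (forall k, (k < p)%N -> arr (J k) <= arr (J p)) ->
  (forall k, (k < p)%N -> x k = Some i -> dur (J k) i = (dur_nat J i k)%:R) ->
  (0 < dur_nat J i p)%N -> dur (J p) i = (dur_nat J i p)%:R ->
  gr_loss eta beta (hist J x p) (J p) i =
  loss_at eta (beta `^ (cap i)%:R^-1) (fun k => arr (J k))
    (fun k => rate (J k) i) (dur_nat J i) (fun k => x k == Some i) p.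
Proof.
move=> b0 arrp durx dp durp.
rewrite /gr_loss durp big_grid//; apply: eq_bigr => k _.
have -> : active_rates (hist J x p) i (arr (J p) + k%:R) =
    sort >=%R (rates_at (fun k => arr (J k)) (fun k => rate (J k) i)
      (dur_nat J i) (fun k => x k == Some i) (arr (J p) + k%:R) p).
  rewrite /active_rates /rates_at /hist filter_map -map_comp; congr (sort _ _).
  rewrite (_ : [seq h <- iota 0 p | _] = [seq k0 <- iota 0 p | (x k0 == Some i)
    && (arr (J k0) <= arr (J p) + k%:R < arr (J k0) + (dur_nat J i k0)%:R)])//.
  apply: eq_in_filter => h; rewrite mem_iota add0n /= => hp.
  rewrite /assigned /=; case: eqP => //= xh; rewrite durx//.
  by rewrite (le_trans (arrp _ hp))//= lerDl.
rewrite /level_loss Psi_level//; apply: eq_bigr => l _.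
by rewrite Psi_level.
Qed.

(** * Feasibility and reward comparison on a fixed instance *)

Section Class.
Context {R : realType} (delta D : R) (delta_ge1 : 1 <= delta).
Context (eta beta : R) (eta_gt0 : 0 < eta) (beta_gt1 : 1 < beta).
Context (A : online_alg R) (A_GR : is_GR_BAL eta beta A).
Context (S : system) (I : instance R (nserv S)) (IK : GR_class delta D I).

Let m := njobs I.
Let J0 : job R (nserv S) := Job 0 finset.set0 (fun=> 0) (fun=> 0).
Let J k := nth J0 (jobs I) k.
Let pre p := foldl (fun h K => rcons h (K, A h K)) [::] (take p (jobs I)).
Let a p := A (pre p) (J p).

Lemma pre_hist p : (p <= m)%N -> pre p = hist J a p.
Proof.
elim: p => [|p IH] pm; first by rewrite /pre take0.
rewrite histS -IH 1?ltnW// /pre (take_nth J0) ?size_tuple//.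
by rewrite foldl_rcons.
Qed.

Lemma run_hist : run A I = hist J a m.
Proof. by rewrite -pre_hist// /pre take_oversize// size_tuple. Qed.

Lemma jobsE p (pm : (p < m)%N) : J p = tnth (jobs I) (Ordinal pm).
Proof. by rewrite (tnth_nth J0). Qed.

Lemma arr_ge0 p : (p < m)%N -> 0 <= arr (J p).
Proof. by move=> pm; rewrite jobsE; case: IK => -[+ _ _] _ _. Qed.

Lemma arr_mono p p' : (p <= p')%N -> (p' < m)%N -> arr (J p) <= arr (J p').
Proof.
move=> pp' pm'; have pm := leq_ltn_trans pp' pm'.
by rewrite (jobsE pm) (jobsE pm'); case: IK => -[_ + _] _ _; apply.
Qed.

Lemma compat_dur p i : (p < m)%N -> i \in compat (J p) ->
  [/\ 0 < rate (J p) i, dur (J p) i <= D, dur (J p) i = (dur_nat J i p)%:R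
    & (0 < dur_nat J i p)%N].
Proof.
move=> pm; rewrite /dur_nat (jobsE pm) => ip.
case: IK => -[_ _ /(_ _ _ ip)[r0 d0]] [/(_ _ _ ip)/andP[d1 dD] _] /(_ _ _ ip) dZ.
have dN : dur (tnth (jobs I) (Ordinal pm)) i \is a Num.nat.
  by rewrite natrEint dZ ltW.
by split; rewrite ?truncnK// -(ltr_nat R) truncnK.
Qed.

Lemma rate_ratio p p' i : (p < m)%N -> (p' < m)%N ->
  i \in compat (J p) -> i \in compat (J p') ->
  `|arr (J p) - arr (J p')| <= D -> rate (J p) i <= delta * rate (J p') i.
Proof.
move=> pm pm' ip ip' tD; have [r0 _ _ _] := compat_dur pm' ip'.
rewrite -ler_pdivrMr//; move: ip ip' tD; rewrite (jobsE pm) (jobsE pm') => ip ip' tD.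
by case: IK => _ [_ /(_ _ _ _ ip ip' tD)/andP[_]].
Qed.

Let c (i : 'I_(nserv S)) : nat := cap i.
Let q i : R := beta `^ (c i)%:R^-1.
Let loss i := loss_at eta (q i) (fun k => arr (J k)) (fun k => rate (J k) i)
  (dur_nat J i) (fun k => a k == Some i).

Lemma q_ge1 i : 1 <= q i.
Proof. by rewrite /q -[leLHS](powRr0 beta) ler_powR ?invr_ge0// ltW. Qed.

Lemma run_balance p (pm : (p < m)%N) :
    let profit i := rate (J p) i * dur (J p) i
                    - gr_loss eta beta (hist J a p) (J p) i in
    match a p with
    | Some i => [/\ i \in compat (J p), 0 < profit i &
                    forall i', i' \in compat (J p) -> profit i' <= profit i]
    | None => forall i, i \in compat (J p) -> profit i <= 0
    end.
Proof. by have := A_GR (pre p) (J p); rewrite /a pre_hist 1?ltnW. Qed.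

Lemma assigned_compat p i : (p < m)%N -> a p = Some i -> i \in compat (J p).
Proof. by move=> pm ap; have := run_balance pm; rewrite ap => -[]. Qed.

Lemma loss_hist p i : (p < m)%N -> i \in compat (J p) ->
  gr_loss eta beta (hist J a p) (J p) i = loss i p.
Proof.
move=> pm ip; have [_ _ dp dp0] := compat_dur pm ip.
apply: gr_loss_hist => // [|k kp|k kp ak].
- exact: le_trans (ltW beta_gt1).
- by rewrite arr_mono// ltnW.
- have km := ltn_trans kp pm.
  by have [] := compat_dur km (assigned_compat km ak).
Qed.

(* If [c i] jobs are active on [i] when [p] arrives, each has rate at least
   [rate (J p) i / delta], so the first grid point alone contributes
   [rate (J p) i / delta * (eta * (beta - 1))] to the loss. *)
Lemma active_lt_cap p i : delta * D <= eta * (beta - 1) ->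
  (p < m)%N -> a p = Some i ->
  (count (fun k => (a k == Some i) && (arr (J p) < arr (J k) + dur (J k) i)%R)
    (iota 0 p) < c i)%N.
Proof.
move=> etaD pm ap; have ip := assigned_compat pm ap.
have [rp0 dD dE d0] := compat_dur pm ip.
have delta0 : 0 < delta by apply: lt_le_trans delta_ge1.
have := run_balance pm; rewrite ap => -[_ + _]; rewrite loss_hist// subr_gt0.
(* A full server would make the loss at least the reward, against the positive profit. *)
rewrite ltnNge; apply: contraTN => full; rewrite -leNgt.
rewrite /loss /loss_at.
move: d0 dE; case: (dur_nat J i p) => // dp _ _.
rewrite big_ord_recl ler_wpDr//.
  by apply: sumr_ge0 => k _; apply: level_loss_ge0 => //; exact: q_ge1.
rewrite /= addr0.
set s := rates_at _ _ _ _ _ _.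
have cs : (c i <= count (>= (rate (J p) i / delta)) s)%N.
  apply: leq_trans full _; rewrite count_rates_at; apply: sub_in_count => k.
  rewrite mem_iota add0n /= => kp /andP[/eqP ak pk].
  have km := ltn_trans kp pm.
  have ik := assigned_compat km ak; have [_ kD kE _] := compat_dur km ik.
  rewrite ak eqxx arr_mono ?(ltnW kp)// -kE pk !andbT /=.
  rewrite ler_pdivrMr// mulrC rate_ratio// ger0_norm ?subr_ge0 ?arr_mono ?(ltnW kp)//.
  by rewrite lerBlDl ltW// (lt_le_trans pk)// lerD2l.
apply: le_trans (level_loss_ge eta_gt0 (q_ge1 i) (rate (J p) i) cs).
rewrite min_l; last by rewrite ler_pdivrMr// ler_peMr// ltW.
have -> : level_weight eta (q i) (c i) = eta * (beta - 1).
  rewrite /level_weight /q -powR_mulrn ?powR_ge0// -powRrM mulVf ?powRr1//.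
    exact: le_trans (ltW beta_gt1).
  by rewrite pnatr_eq0 -lt0n cap_gt0.
rewrite -mulrA ler_pM2l//; apply: le_trans dD _.
by rewrite ler_pdivlMl.
Qed.

(** Consider the last job counted at time [y]: every earlier job active at [y] is still active at
    its arrival, so [active_lt_cap] leaves room for it. *)
Lemma run_feasible : delta * D <= eta * (beta - 1) -> feasible (run A I).
Proof.
move=> etaD; rewrite run_hist; apply/feasible_histP; split.
  by move=> p i; exact: assigned_compat.
move=> i y y0.
have : (m <= m)%N by []; elim: {1 3}m => // p IH pm.
rewrite -addn1 iotaD count_cat /= add0n addn0.
have [/and3P[/eqP ap ty yt]|_] := boolP (_ && _); last by rewrite addn0 IH// ltnW.
rewrite addn1; apply: leq_ltn_trans (active_lt_cap etaD pm ap).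
by apply: sub_count => k /and3P[-> _ /=]; exact: le_lt_trans.
Qed.

Lemma reward_le (o : nat -> option 'I_(nserv S)) (K : R) : 1 <= K ->
  (forall i, (c i)%:R * (q i - 1) <= K) ->
  feasible (S := S) (hist J o m) ->
  reward (hist J o m) <= K * (1 + eta) * reward (run A I).
Proof.
move=> K1 cK /feasible_histP[oc ocap].
rewrite run_hist !reward_hist.
have loss0 i p : 0 <= loss i p by apply: loss_at_ge0 => //; exact: q_ge1.
pose rd p i := rate (J p) i * dur (J p) i.
(* Maximality of the profit: the comparison reward, less its loss, is at most the profit of the run,
   or at most [0] when the run rejects. *)
apply: (@le_trans _ _ (\sum_(p < m) (\sum_(i | a p == Some i) (rd p i - loss i p)
   + \sum_(i | o p == Some i) loss i p))).
  apply: ler_sum => p _; rewrite !sum_option.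
  have pm := ltn_ord p; have := run_balance pm.
  case ap: (a p) => [i|]; case op: (o p) => [j|] /=.
  - have jp := oc _ _ pm op.
    move=> [ip _ /(_ _ jp)]; rewrite !loss_hist// -/(rd p i) -/(rd p j) => ?.
    lra.
  - by move=> [ip + _]; rewrite loss_hist// addr0 => /ltW.
  - by have jp := oc _ _ pm op; move=> /(_ _ jp); rewrite loss_hist// add0r subr_le0.
  - by rewrite addr0.
rewrite big_split /= (exchange_big_dep xpredT)//=.
rewrite [X in _ + X](exchange_big_dep xpredT)//=.
rewrite [X in _ <= _ * X](exchange_big_dep xpredT)//= -big_split mulr_sumr /=.
apply: ler_sum => i _.
have durE p : (p < m)%N -> a p = Some i -> dur (J p) i = (dur_nat J i p)%:R.
  by move=> pm ap; have [] := compat_dur pm (assigned_compat pm ap).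
have r0 p : (p < m)%N -> a p == Some i -> 0 <= rate (J p) i.
  by move=> pm /eqP ap; have [/ltW] := compat_dur pm (assigned_compat pm ap).
pose B := \big[Num.max/0]_(p < m) rate (J p) i.
have bound : \sum_(p < m | o p == Some i) loss i p <=
    K * \sum_(p < m | a p == Some i) (loss i p + eta * rd p i).
  apply: (@le_trans _ _ ((c i)%:R * (q i - 1) *
      \sum_(p < m | a p == Some i) (loss i p + eta * rd p i))).
    rewrite [in leRHS](eq_bigr (fun p : 'I_m =>
      loss i p + eta * (rate (J p) i * (dur_nat J i p)%:R))); last first.
      by move=> p /eqP ap; rewrite /rd durE.
    apply: (@server_bound _ eta (q i) eta_gt0 (q_ge1 i) _ _ _ _ m
      arr_mono arr_ge0 r0 (fun k => o k == Some i) (c i) B).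
    - move=> p pm _.
      exact: (le_bigmax _ (fun p : 'I_m => rate (J p) i) (Ordinal pm)).
    - move=> y y0; apply: leq_trans (ocap i y y0); apply: sub_in_count => p.
      rewrite mem_iota add0n /= => pm /andP[/eqP op]; rewrite op eqxx.
      by have [_ _ -> _] := compat_dur pm (oc _ _ pm op).
  rewrite ler_wpM2r// sumr_ge0// => p ap; rewrite addr_ge0// mulr_ge0 ?(ltW eta_gt0)//.
  rewrite mulr_ge0 ?r0//.
  by rewrite durE//; apply/eqP.
apply: le_trans (lerD (lexx _) bound) _.
rewrite !mulr_sumr -big_split /=; apply: ler_sum => p /eqP ap.
have pm := ltn_ord p; have := run_balance pm; rewrite ap => -[ip + _].
rewrite loss_hist// -/(rd p i); move: (loss i p) (rd p i) => L r L_lt.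
(* The slack is nonnegative because [K >= 1] and accepted jobs have positive profit. *)
rewrite -subr_ge0 (_ : _ - _ = (K - 1) * (r - L)); last by ring.
by rewrite mulr_ge0 ?subr_ge0// -subr_ge0 ltW.
Qed.

Lemma OPT_le (K : R) : 1 <= K -> (forall i, (c i)%:R * (q i - 1) <= K) ->
  OPT I <= K * (1 + eta) * ALG A I.
Proof.
move=> K1 cK; apply: bigmax_le => [|o].
  (* The default [0] of the maximum in [OPT] requires a nonnegative right-hand side. *)
  rewrite mulr_ge0 ?mulr_ge0 ?addr_ge0 ?(ltW eta_gt0) ?(le_trans _ K1)//.
  rewrite /ALG run_hist reward_hist sumr_ge0// => p _; rewrite sumr_ge0// => i /eqP ap.
  have [r0 _ -> _] := compat_dur (ltn_ord p) (assigned_compat (ltn_ord p) ap).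
  by rewrite mulr_ge0// ltW.
have -> : zip (jobs I) o = hist J (nth None o) m.
  apply: (@eq_from_nth _ (J0, None)).
    by rewrite /hist size_map size_iota size_zip !size_tuple minnn.
  rewrite size_zip !size_tuple minnn => p pm.
  rewrite nth_zip ?size_tuple// /hist (nth_map 0%N) ?size_iota// nth_iota//.
by move=> /asboolP; exact: reward_le.
Qed.

End Class.

Lemma limn_esup_le {R : realType} (u : nat -> \bar R) (N : nat) (x : \bar R) :
  (forall k, (N <= k)%N -> (u k <= x)%E) -> (limn_esup u <= x)%E.
Proof.
move=> ux.
apply: le_trans (_ : ereal_sup (image [set k | (N <= k)%N] u) <= _)%E.
  apply: ereal_inf_lbound; exists [set k | (N <= k)%N]%classic => //.
  exact: nbhs_infty_ge.
by apply: ge_ereal_sup => _ [k Nk <-]; exact: ux.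
Qed.

(** * Choice of the parameters *)

Section Tuning.
Context {R : realType}.

Lemma expR1_ge2 : 2 <= expR (1 : R).
Proof. by have := expR_ge1Dx (1 : R); rewrite -[1 + 1]/(2 : R). Qed.

(* With [y = b / c], [expR y * (1 - y) <= 1] and [y * (b + 1) <= 1] give
   [b * expR y <= b + 1], while [expR y - 1 <= y * expR y]. *)
Lemma capacity_expR_le (b : R) (c : nat) : 0 < b -> b * (b + 1) <= c%:R ->
  c%:R * (expR b `^ c%:R^-1 - 1) <= b + 1.
Proof.
move=> b0 bc; have c0 : 0 < c%:R :> R.
  by apply: lt_le_trans bc; rewrite mulr_gt0// addr_gt0.
rewrite -expRM; set y := b / c%:R.
have cy : c%:R * y = b by rewrite /y mulrC divfK// gt_eqF.
have yb : y * (b + 1) <= 1 by rewrite /y mulrAC ler_pdivrMr// mul1r.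
have X0 : 0 < expR y := expR_gt0 y.
have X1 : expR y * (1 - y) <= 1.
  rewrite -[leRHS](mulfV (lt0r_neq0 X0)) ler_pM2l// -expRN.
  exact: expR_ge1Dx.
set X := expR y in X0 X1 *; clearbody X; clearbody y.
have bX : b * X <= b + 1.
  have h : X * (y * (b + 1)) <= X by rewrite ler_piMr// ltW.
  have h2 : (X * (1 - y)) * (b + 1) <= b + 1.
    by rewrite ler_piMl// addr_ge0// ltW.
  lra.
apply: le_trans bX; rewrite -cy -mulrA ler_pM2l//.
by rewrite mulrC; lra.
Qed.

(** Here [b] is [ln beta] and [b^-1] is [eta]. The two conditions are those of [run_feasible] and of
    the ratio [K * (1 + eta)] with [K = b + 1]. *)
Lemma parameter_spec (delta D : R) : 1 <= delta -> 1 <= D ->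
  exists b : R, [/\ 0 < b, delta * D <= b^-1 * (expR b - 1) &
    (b + 1) * (1 + b^-1) <= Gamma_ratio (3 * expR 1 + 6) delta D].
Proof.
move=> d1 D1; set m := ln (Num.max delta D).
have d0 : 0 < delta by apply: lt_le_trans d1.
have D0 : 0 < D by apply: lt_le_trans D1.
have e2 := expR1_ge2.
(* The truncation gives [M >= 1], hence [ln M >= 0], at the threshold of [Gamma_ratio]. *)
pose M := Num.max m (expR 1 - 1).
have M1 : 1 <= M by rewrite le_max; apply/orP; right; lra.
have M0 : 0 < M by apply: lt_le_trans M1.
pose L := ln (delta * D).
have LE : L = ln delta + ln D by rewrite /L lnM.
have L0 : 0 <= L by rewrite LE addr_ge0// ln_ge0.
have mx0 : 0 < Num.max delta D by rewrite lt_max d0.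
have LM : L <= 2 * M.
  have mM : m <= M by rewrite le_max lexx.
  have : ln delta <= m by rewrite ler_ln// le_max lexx.
  have : ln D <= m by rewrite ler_ln// le_max lexx orbT.
  by rewrite LE; lra.
have lnM0 : 0 <= ln M by rewrite ln_ge0.
have lnMM : ln M <= M by rewrite ltW// ln_sublinear.
(* The summand [3] yields a factor [e^3 >= 8], which absorbs [b <= 6 * M] and the extra [1]. *)
pose b := L + ln M + 3; have b3 : 3 <= b by rewrite /b; lra.
have b0 : 0 < b by lra.
exists b; split=> //.
  rewrite ler_pdivlMl// lerBrDr.
  have -> : expR b = delta * D * M * expR 1 ^+ 3.
    by rewrite /b !expRD /L !lnK ?posrE ?mulr_gt0// -expRM_natl mulr1.
  have P1 : 1 <= delta * D by rewrite mulr_ege1.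
  have e8 : 8 <= expR (1 : R) ^+ 3.
    have -> : 8 = 2 ^+ 3 :> R by ring.
    by rewrite lerXn2r// nnegrE ?expR_ge0.
  have PM1 : 1 <= delta * D * M by rewrite mulr_ege1.
  apply: (@le_trans _ _ (delta * D * M * 8)); last first.
    by rewrite ler_pM2l// (lt_le_trans ltr01).
  have b6 : b <= 6 * M by rewrite /b; lra.
  have : b * (delta * D) <= 6 * M * (delta * D) by rewrite ler_pM2r// mulr_gt0.
  lra.
(* The product expands to [b + 2 + b^-1]. *)
apply: (@le_trans _ _ (b + 3)).
  have bV : b * b^-1 = 1 by rewrite mulfV// gt_eqF.
  have : b^-1 <= 1 by rewrite invf_le1//; lra.
  lra.
rewrite /Gamma_ratio -/m -/L /b /M; case: ifPn => [em|].
  by rewrite (max_l em); lra.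
rewrite -ltNge => me.
(* Below the threshold [M] is constant, so [b + 3 <= 3 * M + 6] is bounded. *)
have ME : M = expR 1 - 1 by rewrite /M (max_r (ltW me)).
move: LM lnMM; rewrite -/M ME => ? ?; lra.
Qed.

End Tuning.

Theorem theorem3 (R : realType) :
  exists C : R,
  forall delta D : R, 1 <= delta -> 1 <= D ->
  exists eta beta : R, 0 < eta /\ 1 < beta /\
  forall A : online_alg R, is_GR_BAL eta beta A ->
    (forall (S : system) (I : instance R (nserv S)),
       GR_class delta D I -> feasible (run A I)) /\
    asymptotically_competitive (GR_class delta D) (ALG A)
      (Gamma_ratio C delta D).
Proof.
exists (3 * expR 1 + 6) => delta D d1 D1.
have [b [b0 bD bGamma]] := parameter_spec d1 D1.
have eta0 : 0 < b^-1 by rewrite invr_gt0.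
have beta1 : 1 < expR b by rewrite expR_gt1.
exists b^-1, (expR b); split=> //; split=> // A A_GR; split=> [S I IK|].
  exact: (run_feasible d1 eta0 beta1 A_GR IK bD).
(* Beyond this capacity [capacity_expR_le] applies with [K = b + 1]. *)
apply: (@limn_esup_le _ _ (Num.bound (b * (b + 1)))) => k kN.
have kb : b * (b + 1) <= k%:R.
  apply: le_trans (_ : (Num.bound (b * (b + 1)))%:R <= _); last by rewrite ler_nat.
  by rewrite ltW// archi_boundP// mulr_ge0 ?addr_ge0// ltW.
apply: ge_ereal_sup => _ [S [I [[_ capk] IK OPT_neq0 ->]]].
have OPT_gt0 : 0 < OPT I by rewrite lt_neqAle eq_sym OPT_neq0 bigmax_ge_id.
have OPT_ALG : OPT I <= (b + 1) * (1 + b^-1) * ALG A I.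
  apply: (OPT_le eta0 beta1 A_GR IK); first by rewrite lerDr ltW.
  move=> i; apply: capacity_expR_le => //.
  by rewrite (le_trans kb)// ler_nat.
(* This rules out the value [+oo] of a quotient by [0] in [\bar R]. *)
have ALG_gt0 : 0 < ALG A I.
  have := lt_le_trans OPT_gt0 OPT_ALG; rewrite pmulr_rgt0//.
  by rewrite mulr_gt0// addr_gt0.
rewrite inver gt_eqF// -EFinM lee_fin ler_pdivrMr//.
by rewrite (le_trans OPT_ALG)// ler_pM2r.
Qed.
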